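(* Let $X$ be a real normed linear space and let $A\subseteq X$ be a nonempty bounded subset. Then the following are equivalent: (1) $A$ is $M$-compact. (2) Every statistically maximizing sequence in $A$ has a convergent subsequence (with limit in $A$). (3) Every statistically maximizing sequence in $A$ has a statistically convergent subsequence (with statistical limit in $A$).
   Context: For a nonempty bounded subset $G$ of a real normed linear space $X$ and $x\in X$, $\delta(x,G)=\sup\{\|x-e\|: e\in G\}$. A sequence $(x_n)$ in $G$ is a maximizing sequence in $G$ if there exists $x\in X$ such that $\|x_n-x\|\to\delta(x,G)$. The set $G$ is called $M$-compact if every maximizing sequence in $G$ has a subsequence converging (in norm) to an element of $G$. A sequence $(x_n)_{n\in\mathbb N}$ in a normed linear space is statistically convergent to $x$ if for each $\varepsilon>0$, $\lim_{n\to\infty}\frac1n|\{k\le n:\|x_k-x\|\ge\varepsilon\}|=0$. A subsequence $(x_{n_k})_{k\in\mathbb N}$ is said to be statistically convergent if it is so as a sequence indexed by $k\in\mathbb N$. A sequence $(x_n)$ in $G$ is statistically maximizing in $G$ if there exists $x\in X$ such that the real sequence $(\|x_n-x\|)_{n\in\mathbb N}$ is statistically convergent to $\delta(x,G)$. *)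

(* Defs.v *)
From HB Require Import structures.
From mathcomp Require Import all_boot all_order all_algebra.
From mathcomp Require Import all_classical all_reals all_analysis.

Set Implicit Arguments.
Unset Strict Implicit.
Unset Printing Implicit Defensive.

Import Order.TTheory GRing.Theory Num.Theory.
Import numFieldNormedType.Exports.
Local Open Scope classical_set_scope.
Local Open Scope ring_scope.

Definition far_dist (R : realType) (X : normedModType R) (x : X) (G : set X) : R :=
  sup [set `|x - e| | e in G].

(* Sequences are indexed from 0, so the first n.+1 terms are those of index
   k < n.+1, and the averages are taken over n.+1 terms. *)
Definition stat_cvg (R : realType) (V : normedModType R) (u : nat -> V) (l : V) : Prop :=
  forall eps : R, 0 < eps ->
    (#|[pred k : 'I_n.+1 | eps <= `|u k - l|]|%:R / n.+1%:R : R) @[n --> \oo] --> (0 : R).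

Definition maximizing (R : realType) (X : normedModType R) (G : set X)
    (u : nat -> X) : Prop :=
  (forall n, G (u n)) /\
  exists x : X, (`|u n - x| : R) @[n --> \oo] --> far_dist x G.

Definition stat_maximizing (R : realType) (X : normedModType R) (G : set X)
    (u : nat -> X) : Prop :=
  (forall n, G (u n)) /\
  exists x : X, stat_cvg (fun n => `|u n - x| : R) (far_dist x G).

Definition has_cvg_subseq_in (R : realType) (X : normedModType R) (G : set X)
    (u : nat -> X) : Prop :=
  exists phi : nat -> nat, increasing_seq phi /\
  exists2 l : X, G l & u (phi k) @[k --> \oo] --> l.

Definition has_stat_cvg_subseq_in (R : realType) (X : normedModType R) (G : set X)
    (u : nat -> X) : Prop :=
  exists phi : nat -> nat, increasing_seq phi /\
  exists2 l : X, G l & stat_cvg (fun k => u (phi k)) l.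

Definition M_compact (R : realType) (X : normedModType R) (G : set X) : Prop :=
  forall u : nat -> X, maximizing G u -> has_cvg_subseq_in G u.

(* Main.v *)
Require Import Defs.
From HB Require Import structures.
From mathcomp Require Import all_boot all_order all_algebra.
From mathcomp Require Import all_classical all_reals all_analysis.
From mathcomp Require Import zify.

Set Implicit Arguments.
Unset Strict Implicit.
Unset Printing Implicit Defensive.

Import Order.TTheory GRing.Theory Num.Theory.
Import numFieldNormedType.Exports.
Local Open Scope classical_set_scope.
Local Open Scope ring_scope.

(** The real content is the comparison of ordinary and statistical limits.
Ordinary convergence implies statistical convergence, because only finitely
many terms lie outside a given ball around the limit ([cvg_stat_cvg]).
Conversely, statistical convergence forces the sequence to visit every ball
around its limit at arbitrarily large indices: otherwise the proportion of
indices outside that ball would tend to 1.  The limit is therefore a cluster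
value, and a subsequence converges to it in norm ([stat_cvg_subseq]).

Each equivalence follows by extracting subsequences.  If A is M-compact and
u is statistically maximizing with witness x, then along a subsequence the
norms of u - x converge to the farthest distance, so that this subsequence is
maximizing and M-compactness gives a further subsequence converging in A.
A maximizing sequence is statistically maximizing, which gives the converse.
In the second equivalence, a statistically convergent subsequence has itself
a convergent subsequence, with the same limit. *)

Lemma increasing_seq_comp (f g : nat -> nat) :
  increasing_seq f -> increasing_seq g -> increasing_seq (f \o g).
Proof. by move=> incf incg m n /=; rewrite incf; exact: incg. Qed.

Section StatisticalConvergence.
Context {R : realType} {V : normedModType R}.
Implicit Types (u : nat -> V) (l : V).

(** The number of terms far from the limit is bounded by a constant N, so
their proportion is at most N times a term of the harmonic sequence. *)
Lemma cvg_stat_cvg u l : u @ \oo --> l -> stat_cvg u l.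
Proof.
move=> /cvgrPdist_lt ul eps eps0; have [N _ near_l] := ul _ eps0.
have far_le n : (#|[pred k : 'I_n.+1 | (eps <= `|u k - l|)%R]| <= N)%N.
  have far_lt (k : 'I_n.+1) : eps <= `|u k - l| -> (k < N)%N.
    rewrite leNgt; apply: contraNltn => Nk.
    by rewrite distrC; exact: near_l.
  rewrite cardE -(size_map val) -[leqRHS](size_iota 0).
  apply: uniq_leq_size; first by rewrite map_inj_uniq ?enum_uniq //; exact: val_inj.
  move=> j /mapP[k]; rewrite mem_enum inE => /far_lt kN ->.
  by rewrite mem_iota.
apply: (@squeeze_cvgr _ _ _ _ (cst 0) (fun n => N%:R * harmonic n)).
- near=> n; rewrite divr_ge0 //= ler_pM2r ?invr_gt0 ?ltr0n //.
  by rewrite ler_nat.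
- exact: cvg_cst.
- by rewrite -[X in _ --> X](mulr0 (N%:R : R)); exact: cvgM (cvg_cst _) cvg_harmonic.
Unshelve. all: by end_near. Qed.

(** If the terms of index at least N all stayed at distance eps from the
limit, then for n >= 2N at least half of the first n + 1 terms would. *)
Lemma stat_cvg_frequently u l (eps : R) (N : nat) : stat_cvg u l -> 0 < eps ->
  exists2 n, (N <= n)%N & `|u n - l| < eps.
Proof.
move=> ul eps0; apply: contrapT => noclose.
have far n : (N <= n)%N -> eps <= `|u n - l|.
  by move=> Nn; rewrite leNgt; apply/negP => close; apply: noclose; exists n.
have half0 : 0 < 2^-1 :> R by rewrite invr_gt0.
have [M _ small] := (cvgrPdist_lt _ _).1 (ul _ eps0) _ half0.
(* Beyond M the proportion of far terms is below 1/2; the summand N + N makes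
   the terms of index at least N a majority of the first n + 1. *)
pose n := (M + N + N)%N.
have Mn : (M <= n)%N by rewrite /n; lia.
have /= := small n Mn; rewrite sub0r normrN ger0_norm ?divr_ge0 //.
rewrite ltr_pdivrMr ?ltr0n // ltr_pdivlMl // -natrM ltr_nat ltnNge => /negP; apply.
have card_far : (n.+1 - N <= #|[pred k : 'I_n.+1 | (eps <= `|u k - l|)%R]|)%N.
  rewrite cardE -(size_map val) -[leqLHS](size_iota N).
  apply: uniq_leq_size; first exact: iota_uniq.
  move=> k; rewrite mem_iota => /andP[Nk kn].
  have {}kn : (k < n.+1)%N by rewrite /n in kn *; lia.
  by apply/mapP; exists (Ordinal kn); rewrite // mem_enum inE; exact: far.
by rewrite /n in card_far *; lia.
Qed.

(** It suffices to extract from the real sequence of distances to l, of which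
0 is a cluster value. *)
Lemma stat_cvg_subseq u l : stat_cvg u l ->
  exists2 phi : nat -> nat, increasing_seq phi & u (phi k) @[k --> \oo] --> l.
Proof.
move=> ul; pose dist n := `|u n - l|.
have dist_cluster : cluster (dist @ \oo) 0.
  apply/cluster_eventuallyP => e N e0.
  have [n Nn un] := stat_cvg_frequently N ul e0.
  by exists n; rewrite // sub0r normrN normr_id ltW.
have [phi inc_phi dist0] := (cluster_eventually_cvg _ _).1 dist_cluster.
exists phi => //; apply/subr_cvg0/norm_cvg0P; exact: dist0.
Qed.

End StatisticalConvergence.

Theorem proposition3p9 (R : realType) (X : normedModType R) (A : set X)
    (A_nonempty : A !=set0) (A_bounded : bounded_set A) :
  (M_compact A <->
     (forall u : nat -> X, stat_maximizing A u -> has_cvg_subseq_in A u)) /\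
  ((forall u : nat -> X, stat_maximizing A u -> has_cvg_subseq_in A u) <->
     (forall u : nat -> X, stat_maximizing A u -> has_stat_cvg_subseq_in A u)).
Proof.
split; split.
- move=> Mcpt u [Au [x ux]].
  have [phi inc_phi phix] := stat_cvg_subseq ux.
  have [|psi [inc_psi [l Al psil]]] := Mcpt (u \o phi).
    by split; [move=> n; exact: Au|exists x].
  exists (phi \o psi); split; first exact: increasing_seq_comp.
  by exists l.
- move=> statM u [Au [x ux]]; apply: statM; split => //.
  by exists x; exact: cvg_stat_cvg.
- move=> sub u /sub[phi [inc_phi [l Al ul]]].
  by exists phi; split => //; exists l => //; exact: cvg_stat_cvg.
- move=> sub u /sub[phi [inc_phi [l Al /stat_cvg_subseq[psi inc_psi ul]]]].
  exists (phi \o psi); split; first exact: increasing_seq_comp.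
  by exists l.
Qed.
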